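(* The sequence $\{H_n\}_{n\ge1}$ satisfies the Large Deviation Principle on $[0,1]$ with a good rate function. More precisely, for every continuous bounded $g:[0,1]\to\mathbb R$ the limit $\Gamma_g=\lim_{n\to\infty}\frac1n\log\mathbb{E}\big(e^{n g(H_n/n)}\big)$ exists, and with $$R(x)=\sup_{g\in\mathcal C_b([0,1])}\{g(x)-\Gamma_g\},\qquad x\in[0,1],$$ $R$ is a good rate function and: for every closed $F\subseteq[0,1]$, $\limsup_{n\to\infty}\frac1n\log\mathbb P(H_n/n\in F)\le-\inf_{x\in F}R(x)$; for every open $G\subseteq[0,1]$ (in the relative topology), $\liminf_{n\to\infty}\frac1n\log\mathbb P(H_n/n\in G)\ge-\inf_{x\in G}R(x)$.
   Context: Standing setup (discrete-time Hawkes process, DTHP). Let $(a_i)_{i=0}^\infty$ be a sequence of strictly positive real numbers with $\sum_{i=0}^\infty a_i<1$ and $\sum_{i=1}^\infty i\,a_i<\infty$. The arrival process $\{\xi_n\}_{n\ge1}$ is a sequence of $\{0,1\}$-valued random variables on a probability space $(\Omega,\mathcal F,\mathbb P)$ with $\mathbb{P}(\xi_1=1)=a_0$, $\mathbb P(\xi_1=0)=1-a_0$, and for $n\ge2$, $$\mathbb{P}(\xi_n=1\mid \xi_1,\dots,\xi_{n-1})=a_0+\sum_{i=1}^{n-1}a_{n-i}\xi_i,\qquad \mathbb{P}(\xi_n=0\mid \xi_1,\dots,\xi_{n-1})=1-\Big(a_0+\sum_{i=1}^{n-1}a_{n-i}\xi_i\Big).$$ The DTHP is $H_n=\sum_{i=1}^n\xi_i$,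 and $\mathcal F_n=\sigma(\xi_1,\dots,\xi_n)$. A rate function is a lower semicontinuous $I:[0,1]\to[0,\infty]$; it is good if its sublevel sets are compact. $\mathcal C_b([0,1])$ denotes the bounded continuous real functions on $[0,1]$. *)

(* Defs.v *)
From HB Require Import structures.
From mathcomp Require Import all_boot all_order all_algebra.
From mathcomp Require Import all_classical all_reals all_analysis.
Set Implicit Arguments. Unset Strict Implicit. Unset Printing Implicit Defensive.
Import Order.TTheory GRing.Theory Num.Theory.
Import numFieldNormedType.Exports.
Local Open Scope classical_set_scope.
Local Open Scope ring_scope.

Definition DTHP_H {R : realType} {T : Type} (xi : nat -> T -> bool) (n : nat) (w : T) : R :=
  \sum_(1 <= i < n.+1) ((xi i w : nat)%:R).

Definition prefix_event {T : Type} (xi : nat -> T -> bool) (n : nat) (s : nat -> bool) : set T :=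
  [set w | forall i, (1 <= i < n)%N -> xi i w = s i].

Definition hawkes_coeffs {R : realType} (a : nat -> R) : Prop :=
  (forall i, 0 < a i) /\
  cvgn (series a) /\ limn (series a) < 1 /\
  cvgn (series (fun i => i%:R * a i)).

(* The process (xi_n)_{n>=1} on (Omega, P) is a DTHP with coefficients a:
   each xi_n is measurable, and for every n >= 1 and every history s,
   P(xi_1 = s_1, ..., xi_{n-1} = s_{n-1}, xi_n = 1)
     = (a_0 + sum_{i=1}^{n-1} a_{n-i} s_i) * P(xi_1 = s_1, ..., xi_{n-1} = s_{n-1}),
   which is the elementary meaning of the conditional probabilities of the
   paper (for n = 1 it reads P(xi_1 = 1) = a_0). *)
Definition is_DTHP {R : realType} {d : measure_display} {T : measurableType d}
    (P : probability T R) (a : nat -> R) (xi : nat -> T -> bool) : Prop :=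
  (forall n, measurable [set w | xi n w]) /\
  (forall (n : nat) (s : nat -> bool), (1 <= n)%N ->
     P (prefix_event xi n s `&` [set w | xi n w]) =
     ((a 0%N + \sum_(1 <= i < n) a (n - i)%N * (s i : nat)%:R)%:E
        * P (prefix_event xi n s))%E).

(* Bounded continuous real functions on [0,1] (values outside [0,1] are irrelevant). *)
Definition Cb01 {R : realType} (g : R -> R) : Prop :=
  {within `[0, 1], continuous g} /\ exists M : R, forall x, x \in `[0, 1] -> `|g x| <= M.

Definition Gamma_seq {R : realType} {d : measure_display} {T : measurableType d}
    (P : probability T R) (xi : nat -> T -> bool) (g : R -> R) (n : nat) : R :=
  n%:R^-1 * ln (fine (\int[P]_w (expR (n%:R * g (DTHP_H xi n w / n%:R)))%:E)).

Definition Gamma {R : realType} {d : measure_display} {T : measurableType d}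
    (P : probability T R) (xi : nat -> T -> bool) (g : R -> R) : R :=
  limn (Gamma_seq P xi g).

Definition rateR {R : realType} {d : measure_display} {T : measurableType d}
    (P : probability T R) (xi : nat -> T -> bool) (x : R) : \bar R :=
  ereal_sup [set ((g x - Gamma P xi g)%:E) | g in Cb01].

Definition good_rate_function01 {R : realType} (I : R -> \bar R) : Prop :=
  (forall x, x \in `[0, 1] -> (0 <= I x)%E) /\
  (forall alpha : R, closed [set x | x \in `[0, 1] /\ (I x <= alpha%:E)%E]) /\
  (forall alpha : R, compact [set x | x \in `[0, 1] /\ (I x <= alpha%:E)%E]).

(* (1/n) log P(H_n / n in A), in extended reals (log 0 = -oo). *)
Definition ldp_seq {R : realType} {d : measure_display} {T : measurableType d}
    (P : probability T R) (xi : nat -> T -> bool) (A : set R) (n : nat) : \bar R :=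
  ((n%:R^-1)%:E * lne (P [set w | A (DTHP_H xi n w / n%:R)%R]))%E.

(* Main.v *)
(** Given its past, the process forgets: an old arrival at lag [i] changes the
    arrival probability by [a i], so older history changes the law of the next
    [m] steps by a likelihood ratio bounded below by a constant depending only on
    [sum i * a i]. Hence, for concave [g], [E exp(n g(H_n / n))] is
    supermultiplicative up to a constant and Fekete's lemma yields [Gamma_g].
    A continuous [g] on [0, 1] is uniformly approximated by maxima of finitely
    many concave cones [b - K |x - y|], and the exponential rate of a finite sum
    is the largest of the rates, so [Gamma_g] exists for every [g]. The large
    deviation bounds follow as in Bryc's inverse of Varadhan's lemma: compactness
    gives the upper bound, and testing with steep cones gives the lower bound. *)

Require Import Defs.
From HB Require Import structures.
From mathcomp Require Import all_boot all_order all_algebra.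
From mathcomp Require Import all_classical all_reals all_analysis.
From mathcomp Require Import measurable_realfun zify ring lra.
Import Order.TTheory GRing.Theory Num.Theory.
Import numFieldNormedType.Exports.
Local Open Scope classical_set_scope.
Local Open Scope ring_scope.

Set Implicit Arguments.
Unset Strict Implicit.
Unset Printing Implicit Defensive.

(** * Expectations along a history *)

(* Histories are listed newest first, so that the bit at position [i] carries
   the weight [a i.+1]. *)
Definition hist_rate {R : realType} (a : nat -> R) (h : seq bool) : R :=
  a 0%N + \sum_(0 <= i < size h) a i.+1 * (nth false h i)%:R.

(* The expectation of [phi], applied to the number of arrivals among the [m]
   steps that follow the history [h]. *)
Fixpoint hist_mean {R : realType} (a : nat -> R) (h : seq bool) (m : nat)
    (phi : nat -> R) : R :=
  if m is m'.+1 then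
    hist_rate a h * hist_mean a (true :: h) m' (fun k => phi k.+1)
    + (1 - hist_rate a h) * hist_mean a (false :: h) m' phi
  else phi 0%N.

Section HistoryMean.
Variables (R : realType) (a : nat -> R) (A S : R).
Hypothesis a_gt0 : forall i, 0 < a i.
Hypothesis sum_a : forall n, \sum_(0 <= i < n) a i <= A.
Hypothesis A_lt1 : A < 1.
Hypothesis sum_ia : forall n, \sum_(0 <= i < n) i%:R * a i <= S.

Local Notation rate := (hist_rate a).
Local Notation mean := (hist_mean a).
Local Notation tail M j := (\sum_(j <= i < M) a i.+1).

(** Appending [h] only adds older arrivals: the weights of [t] stay put, and the new ones come from
    the coefficients beyond [size t]. The free bound [M] keeps the tails fixed while histories grow
    in later inductions. *)
Lemma hist_rate_cat (t h : seq bool) (M : nat) : (size (t ++ h) <= M)%N ->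
  rate t <= rate (t ++ h) <= rate t + tail M (size t).
Proof.
rewrite size_cat => hM.
rewrite /hist_rate size_cat (big_cat_nat (n := size t) (p := (size t + size h)%N)) ?leq_addr//= addrA.
have -> : \sum_(0 <= i < size t) a i.+1 * (nth false (t ++ h) i)%:R
        = \sum_(0 <= i < size t) a i.+1 * (nth false t i)%:R.
  by rewrite !big_mkord; apply: eq_bigr => i _; rewrite nth_cat ltn_ord.
apply/andP; split.
  rewrite lerDl; apply: sumr_ge0 => i _.
  by rewrite mulr_ge0 ?ler0n// ltW.
rewrite lerD2l [leRHS](big_cat_nat (n := (size t + size h)%N)) ?leq_addr//=.
rewrite -[leLHS]addr0 lerD//; last by apply: sumr_ge0 => i _; rewrite ltW.
apply: ler_sum => i _.
by rewrite ler_piMr ?(ltW (a_gt0 _))// lern1; case: nth.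
Qed.

Lemma hist_rate_bounds (h : seq bool) : 0 < rate h <= A.
Proof.
have := @hist_rate_cat [::] h (size h) (leqnn _).
have -> : rate [::] = a 0%N by rewrite /hist_rate big_geq// addr0.
move=> /= /andP[h1 h2].
rewrite (lt_le_trans (a_gt0 0) h1)/= (le_trans h2)// (le_trans _ (sum_a (size h).+1))//.
by rewrite big_nat_recl.
Qed.

(** Exchanging the sums, [a i.+1] occurs only in the tails with [j <= i], hence at most [i.+1]
    times. This is where the first moment of [a] enters. *)
Lemma sum_tail (m M : nat) : \sum_(0 <= j < m) tail M j <= S.
Proof.
apply: (le_trans _ (sum_ia M.+1)).
rewrite big_nat_recl// mul0r add0r.
elim: M => [|M IH].
  by rewrite [leRHS]big_geq//; apply: sumr_le0 => j _; rewrite big_geq.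
rewrite [leRHS]big_nat_recr//=.
have -> : \sum_(0 <= j < m) tail M.+1 j
   = \sum_(0 <= j < m) tail M j + \sum_(0 <= j < m) (a M.+1 *+ (j <= M)%N).
  rewrite -big_split/=; apply: eq_bigr => j _.
  case: leqP => h; first by rewrite big_nat_recr.
  by rewrite !big_geq ?addr0// ltnW.
rewrite lerD// {IH} mulr_natl.
rewrite sumrMnr ler_pMn2l//.
(* It remains to count the [j < m] with [j <= M]: at most [M.+1]. *)
elim: m M => [|m IH] M; first by rewrite big_geq.
rewrite big_nat_recl//= add1n ltnS.
case: M => [|M]; first by rewrite big1.
by rewrite (leq_trans _ (IH M)).
Qed.

Lemma hist_mean_le (h : seq bool) (m : nat) (phi psi : nat -> R) :
  (forall k, (k <= m)%N -> phi k <= psi k) -> mean h m phi <= mean h m psi.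
Proof.
elim: m h phi psi => [|m IH] h phi psi le_phi /=; first exact: le_phi.
have /andP[r0 r1] := hist_rate_bounds h.
apply: lerD; apply: ler_wpM2l; rewrite ?(ltW r0) ?subr_ge0 ?(le_trans r1) ?(ltW A_lt1)//.
  by apply: IH => k hk; exact: le_phi.
by apply: IH => k hk; apply: le_phi; rewrite ltnW.
Qed.

Lemma hist_mean_lin (h : seq bool) (m : nat) (c : R) (phi psi : nat -> R) :
  mean h m (fun k => c * phi k + psi k) = c * mean h m phi + mean h m psi.
Proof.
elim: m h phi psi => [//|m IH] h phi psi /=.
by rewrite (IH _ phi) (IH _ (fun k => phi k.+1)); ring.
Qed.

Lemma hist_mean_cst (h : seq bool) (m : nat) (c : R) : mean h m (fun=> c) = c.
Proof. by elim: m h => [//|m IH] h /=; rewrite !IH; ring. Qed.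

Lemma hist_meanZ (h : seq bool) (m : nat) (c : R) (phi : nat -> R) :
  mean h m (fun k => c * phi k) = c * mean h m phi.
Proof.
rewrite -[RHS]addr0 -[in RHS](hist_mean_cst h m 0) -hist_mean_lin.
by congr hist_mean; apply/funext => k; rewrite addr0.
Qed.

Lemma hist_mean_sum (h : seq bool) (m : nat) (I : Type) (s : seq I)
    (phi : I -> nat -> R) :
  mean h m (fun k => \sum_(i <- s) phi i k) = \sum_(i <- s) mean h m (phi i).
Proof.
elim: s => [|i s IH].
  rewrite big_nil -[RHS](hist_mean_cst h m).
  by congr hist_mean; apply/funext => k; rewrite big_nil.
rewrite big_cons -IH -[mean h m (phi i)]mul1r -hist_mean_lin.
by congr hist_mean; apply/funext => k; rewrite big_cons mul1r.
Qed.

Lemma hist_mean_ge0 (h : seq bool) (m : nat) (phi : nat -> R) :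
  (forall k, 0 <= phi k) -> 0 <= mean h m phi.
Proof.
by move=> phi0; rewrite -(hist_mean_cst h m 0); apply: hist_mean_le.
Qed.

Lemma hist_mean_gt0 (h : seq bool) (m : nat) (phi : nat -> R) :
  (forall k, 0 < phi k) -> 0 < mean h m phi.
Proof.
elim: m h phi => [|m IH] h phi phi0 /=; first exact: phi0.
have /andP[r0 rA] := hist_rate_bounds h.
by rewrite addr_gt0// mulr_gt0 ?IH// subr_gt0 (le_lt_trans rA).
Qed.

(* Older arrivals raise the probability of a future arrival; they lower the
   probability [1 - rate] of a non-arrival by a factor at least
   [expR (- tail / (1 - A))], and the tails are summable. *)
Lemma hist_mean_cat (t h : seq bool) (m M : nat) (phi : nat -> R) :
  (forall k, 0 <= phi k) -> (size (t ++ h) + m <= M)%N ->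
  expR (- (\sum_(size t <= j < size t + m) tail M j / (1 - A))) * mean t m phi
    <= mean (t ++ h) m phi.
Proof.
elim: m t phi => [|m IH] t phi phi0 hM.
  by rewrite /= addn0 big_geq// oppr0 expR0 mul1r.
have /andP[t0 tA] := hist_rate_bounds t.
have /andP[th0 thA] := hist_rate_bounds (t ++ h).
have /andP[le1 le2] : rate t <= rate (t ++ h) <= rate t + tail M (size t).
  by apply: hist_rate_cat; rewrite (leq_trans _ hM)// leq_addr.
have A1 : 0 < 1 - A by rewrite subr_gt0.
(* The tail at [j = size t] is split off: it gives the loss [e] of the present step, and the
   induction hypothesis pays for the others. *)
rewrite addnS big_ltn ?ltnS ?leq_addr// opprD expRD.
set r := tail M (size t).
set e := expR (- (r / (1 - A))).
have r0 : 0 <= r by apply: sumr_ge0 => i _; rewrite ltW.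
have e0 : 0 < e by exact: expR_gt0.
have e1 : e <= 1 by rewrite expR_le1 oppr_le0 divr_ge0// ltW.
have e2 : e * (1 - rate t) <= 1 - rate (t ++ h).
  (* From [expR x >= 1 + x]. *)
  have ei : e * (1 + r / (1 - A)) <= 1.
    have := expR_ge1Dx (r / (1 - A)) => h1.
    have h2 : e * expR (r / (1 - A)) = 1 by rewrite /e -expRD addNr expR0.
    by apply: le_trans (ler_wpM2l (ltW e0) h1) _; rewrite h2.
  (* Older arrivals take at most [r] from the non-arrival probability; what is left is at least
     [1 - A], so [r] is at most [r / (1 - A)] times it. *)
  have h3 : 1 - rate t <= (1 + r / (1 - A)) * (1 - rate (t ++ h)).
    have : r <= r / (1 - A) * (1 - rate (t ++ h)).
      rewrite mulrAC -mulrA ler_peMr// ler_pdivlMr// mul1r; lra.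
    rewrite mulrDl mul1r => h4; rewrite -/r in le2; lra.
  apply: (le_trans (ler_wpM2l (ltW e0) h3)).
  rewrite mulrA ler_piMl//; lra.
have hs : ((size (t ++ h)).+1 + m = size (t ++ h) + m.+1)%N by rewrite addSnnS.
have IH1 := IH (true :: t) (fun k => phi k.+1) (fun k => phi0 k.+1).
have IH2 := IH (false :: t) phi phi0.
rewrite /= hs in IH1 IH2.
move: (IH1 hM) (IH2 hM); rewrite !addSn.
set E := expR _; set m1 := mean (true :: t) _ _; set m2 := mean (false :: t) _ _.
set m3 := mean (_ :: t ++ h) _ _; set m4 := mean (_ :: t ++ h) _ _ => i1 i2 /=.
rewrite -/m1 -/m2 -/m3 -/m4.
have m10 : 0 <= m1 by apply: hist_mean_ge0.
have m20 : 0 <= m2 by apply: hist_mean_ge0.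
have E0 : 0 < E by exact: expR_gt0.
have -> : e * E * (rate t * m1 + (1 - rate t) * m2)
  = (e * rate t) * (E * m1) + (e * (1 - rate t)) * (E * m2) by ring.
apply: lerD; apply: ler_pM => //.
- by rewrite mulr_ge0// ltW.
- by rewrite mulr_ge0// ltW.
- by rewrite (le_trans _ le1)// ler_piMl// ltW.
- by rewrite mulr_ge0 ?(ltW e0)//; lra.
- by rewrite mulr_ge0// ltW.
Qed.

(** With an empty recent past, [sum_tail] bounds the sum of all tails by [S], whatever [h] and [m]
    are. *)
Lemma hist_mean_forget (h : seq bool) (m : nat) (phi : nat -> R) :
  (forall k, 0 <= phi k) ->
  expR (- (S / (1 - A))) * mean [::] m phi <= mean h m phi.
Proof.
move=> phi0; have := @hist_mean_cat [::] h m _ phi phi0 (leqnn _).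
rewrite /= add0n; apply: le_trans; apply: ler_wpM2r; first exact: hist_mean_ge0.
rewrite ler_expR lerN2 -mulr_suml ler_wpM2r ?sum_tail// invr_ge0 subr_ge0.
exact: ltW.
Qed.

(** Induction over the first [n] steps, an arrival shifting [phi] and [phi1]. Once these steps are
    used up, [hist_mean_forget] erases the accumulated past, so the constant is paid only once. *)
Lemma hist_mean_supermul (h : seq bool) (n m : nat) (phi phi1 phi2 : nat -> R) :
  (forall k, 0 <= phi1 k) -> (forall k, 0 <= phi2 k) ->
  (forall k l, (k <= n)%N -> (l <= m)%N -> phi1 k * phi2 l <= phi (k + l)%N) ->
  expR (- (S / (1 - A))) * (mean h n phi1 * mean [::] m phi2)
    <= mean h (n + m) phi.
Proof.
move=> phi10 phi20.
elim: n h phi phi1 phi10 => [|n IH] h phi phi1 phi10 le_phi.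
  rewrite /= add0n (le_trans _ (hist_mean_le h (psi := phi) (le_phi 0%N ^~ (leqnn 0))))//.
  rewrite hist_meanZ mulrCA ler_wpM2l//; exact: hist_mean_forget.
rewrite addSn /=.
have /andP[r0 rA] := hist_rate_bounds h.
have i1 := IH (true :: h) (fun k => phi k.+1) (fun k => phi1 k.+1) (fun k => phi10 k.+1)
  (fun k l hk hl => le_phi k.+1 l hk hl).
have i2 := IH (false :: h) phi phi1 phi10 (fun k l hk hl => le_phi k l (leqW hk) hl).
have r1 : 0 <= 1 - rate h by rewrite subr_ge0 (le_trans rA) ?(ltW A_lt1).
have := lerD (ler_wpM2l (ltW r0) i1) (ler_wpM2l r1 i2).
by apply: le_trans; rewrite le_eqVlt; apply/orP; left; apply/eqP; ring.
Qed.

End HistoryMean.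

(** * Finite covers and Fekete's lemma *)

Lemma near_infty_all {I : eqType} (s : seq I) (Q : I -> nat -> Prop) :
  (forall y, y \in s -> \forall n \near \oo, Q y n) ->
  \forall n \near \oo, forall y, y \in s -> Q y n.
Proof.
elim: s => [|x s IH] h; first by apply: nearW.
have hx := h x (mem_head x s).
have hs : \forall n \near \oo, forall y, y \in s -> Q y n.
  by apply: IH => y ys; apply: h; rewrite in_cons ys orbT.
near=> n => y; rewrite in_cons => /predU1P[->|]; first by near: n.
by move: y; near: n.
Unshelve. all: by end_near. Qed.

Lemma seq_argmax {R : realType} {I : eqType} (s : seq I) (f : I -> R) :
  s != [::] -> exists2 y, y \in s & forall z, z \in s -> f z <= f y.
Proof.
elim: s => [//|x s IH] _; have [->|/IH[y ys hy]] := eqVneq s [::].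
  by exists x; rewrite ?mem_head// => z; rewrite inE => /eqP->.
have [xy|yx] := leP (f x) (f y).
  exists y; rewrite ?in_cons ?ys ?orbT// => z; rewrite in_cons => /predU1P[->//|].
  exact: hy.
exists x; rewrite ?mem_head// => z; rewrite in_cons => /predU1P[->//|/hy].
by move=> /le_trans; apply; exact: ltW.
Qed.

Lemma compact_ball_cover {R : realType} (F : set R) (delta : R -> R) :
  compact F -> (forall x, F x -> 0 < delta x) ->
  exists2 s : seq R, (forall x, x \in s -> F x) &
    forall y, F y -> exists2 x, x \in s & `|x - y| < delta x.
Proof.
rewrite compact_cover => cF d0.
have [||D' sD cD] := cF R F (fun x => ball x (delta x)).
- by move=> x Fx; exact: ball_open.
- by move=> x Fx; exists x => //; exact: ballxx (d0 _ Fx).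
exists (finmap.enum_fset D') => [x xD|y /cD[x /= xD xy]].
  by have := sD x xD; rewrite inE.
by exists x.
Qed.

(** Subtracting [c] makes [u] superadditive at positive indices; the limit is the supremum of
    [(u n - c) / n]. *)
Lemma almost_superadditive_cvg {R : realType} (u : nat -> R) (c B : R) :
  (forall n m, (0 < n)%N -> (0 < m)%N -> u n + u m - c <= u (n + m)%N) ->
  (forall n, u n <= B * n%:R) ->
  cvgn (fun n => n%:R^-1 * u n).
Proof.
move=> super ub.
pose v n := u n - c.
have vD n m : (0 < n)%N -> (0 < m)%N -> v n + v m <= v (n + m)%N.
  by move=> n0 m0; have := super n m n0 m0; rewrite /v; lra.
pose W := [set n%:R^-1 * v n | n in [set n | (0 < n)%N]].
have n0R n : (0 < n)%N -> (0 < n%:R :> R) by rewrite ltr0n.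
have ubW : has_ubound W.
  exists (B + `|c|) => _ [n /= n0 <-].
  rewrite mulrC ler_pdivrMr ?n0R// /v mulrDl lerD ?ub//.
  by rewrite (le_trans (ler_norm _))// normrN ler_peMr// ler1n.
have supW : has_sup W by split => //; exists (1%:R^-1 * v 1%N), 1%N.
pose l := sup W.
have v_le n : (0 < n)%N -> v n <= l * n%:R.
  move=> n0; rewrite -ler_pdivrMr ?n0R// mulrC.
  by apply: ub_le_sup => //; exists n.
have vM m r q : (0 < m)%N -> (0 < r)%N -> q%:R * v m + v r <= v (q * m + r)%N.
  move=> m0 r0; elim: q => [|q IH]; first by rewrite mul0r add0r mul0n.
  have := vD m (q * m + r)%N m0; rewrite addn_gt0 r0 orbT => /(_ isT).
  by rewrite addnA -mulSn -natr1 mulrDl mul1r; lra.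
apply/cvg_ex; exists l; apply/cvgrPdist_le => /= e e0.
have e20 : 0 < e / 2 by rewrite divr_gt0.
have [_ [m /= m0 <-] hm] := sup_adherent e20 supW.
rewrite -/l in hm.
(* Bounds the loss from the remainder in a division by [m], uniformly in [n]. *)
pose D := m%:R * `|l - e / 2| + \sum_(0 <= r < m.+1) `|v r|.
have D0 : 0 <= D by rewrite addr_ge0 ?mulr_ge0// sumr_ge0.
near=> n.
have n0 : (0 < n)%N by near: n; exact: nbhs_infty_gt.
have hn : (D + `|c|) / (e / 2) <= n%:R by near: n; exact: nbhs_infty_ger.
rewrite ler_pdivrMr// in hn.
have vn : (l - e / 2) * n%:R - D <= v n.
  (* Dividing [n.-1] puts the remainder between [1] and [m], since superadditivity is known for
     positive indices only. *)
  pose q := (n.-1 %/ m)%N; pose r := (n.-1 %% m).+1.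
  have nE : n = (q * m + r)%N by rewrite /r addnS -divn_eq prednK.
  have rm : (r <= m)%N by rewrite /r ltn_mod.
  rewrite {2}nE (le_trans _ (vM m r q m0 isT))//.
  have h1 : q%:R * ((l - e / 2) * m%:R) <= q%:R * v m.
    rewrite ler_wpM2l//; move: hm; rewrite [_^-1 * _]mulrC ltr_pdivlMr ?n0R//.
    by move/ltW.
  have h2 : `|v r| <= \sum_(0 <= r < m.+1) `|v r|.
    rewrite (big_cat_nat (n := r) (p := m.+1))//= ?(leqW rm)//.
    rewrite (big_ltn (m := r)) ?ltnS// addrCA lerDl addr_ge0// sumr_ge0//.
  have h3 : r%:R * (l - e / 2) <= m%:R * `|l - e / 2|.
    apply: (@le_trans _ _ (r%:R * `|l - e / 2|)).
      by rewrite ler_wpM2l// ler_norm.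
    by rewrite ler_wpM2r// ler_nat.
  rewrite {1}nE natrD natrM /D.
  have : - `|v r| <= v r by rewrite lerNnormlW.
  lra.
have := v_le n n0.
have cn := ler_norm c. have cn' := ler_norm (- c). rewrite normrN in cn'.
rewrite ler_norml; set w := _ * u n.
have uE : u n = w * n%:R by rewrite /w mulrAC mulVf ?mul1r// gt_eqF ?n0R.
rewrite /v uE in vn *. move=> h.
apply/andP; split; rewrite -(ler_pM2r (n0R _ n0)); lra.
Unshelve. all: by end_near. Qed.

(** * Existence of the free energy *)

Definition cone {R : realType} (b K y x : R) : R := b - K * `|x - y|.

(** The partition function, that is the expectation of [exp(n g(H_n / n))], written through
    histories so that the limits are taken without measure theory. *)
Definition hist_Z {R : realType} (a : nat -> R) (g : R -> R) (n : nat) : R :=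
  hist_mean a [::] n (fun k => expR (n%:R * g (k%:R / n%:R))).

Definition free_energy {R : realType} (a : nat -> R) (g : R -> R) (n : nat) : R :=
  n%:R^-1 * ln (hist_Z a g n).

Definition hist_prob {R : realType} (a : nat -> R) (n : nat) (B : set R) : R :=
  hist_mean a [::] n (fun k => (`[< B (k%:R / n%:R) >])%:R).

Lemma Cb01_near {R : realType} (g : R -> R) (x e : R) :
  Cb01 g -> x \in `[0, 1] -> 0 < e ->
  exists2 delta, 0 < delta &
    forall y, y \in `[0, 1] -> `|x - y| < delta -> `|g x - g y| <= e.
Proof.
move=> [/subspace_continuousP cg _] x01 e0.
have /cvgrPdist_le/(_ e e0) := cg x x01.
rewrite near_withinE => /nbhs_ballP[d /= d0 hd].
by exists d => // y y01 xy; apply: hd.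
Qed.

Lemma Cb01_cone {R : realType} (b K y : R) : Cb01 (cone b K y).
Proof.
split.
  apply: continuous_subspaceT => x.
  apply: cvgB; first exact: cvg_cst.
  apply: cvgM; first exact: cvg_cst.
  apply: cvg_norm; apply: cvgB; [exact: cvg_id|exact: cvg_cst].
exists (`|b| + `|K| * (1 + `|y|)) => x; rewrite in_itv/= => /andP[x0 x1].
rewrite /cone (le_trans (ler_normB _ _))// lerD2l normrM normr_id ler_wpM2l//.
by rewrite (le_trans (ler_normB _ _))// lerD2r ger0_norm.
Qed.

Lemma ratio_itv {R : realType} (k n : nat) : (k <= n)%N -> (0 < n)%N ->
  (k%:R / n%:R : R) \in `[0, 1].
Proof.
move=> kn n0; rewrite in_itv/= divr_ge0//= ler_pdivrMr ?ltr0n// mul1r ler_nat.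
by [].
Qed.

Section FreeEnergy.
Variables (R : realType) (a : nat -> R) (A S : R).
Hypothesis a_gt0 : forall i, 0 < a i.
Hypothesis sum_a : forall n, \sum_(0 <= i < n) a i <= A.
Hypothesis A_lt1 : A < 1.
Hypothesis sum_ia : forall n, \sum_(0 <= i < n) i%:R * a i <= S.

Local Notation Z := (hist_Z a).
Local Notation fe := (free_energy a).
Local Notation prob := (hist_prob a).

Lemma hist_Z_gt0 (g : R -> R) (n : nat) : 0 < Z g n.
Proof. by apply: (hist_mean_gt0 a_gt0 sum_a A_lt1) => k; exact: expR_gt0. Qed.

Lemma hist_ZE (g : R -> R) (n : nat) : (0 < n)%N -> Z g n = expR (n%:R * fe g n).
Proof.
move=> n0; rewrite /free_energy mulrA mulfV ?pnatr_eq0 -?lt0n// mul1r lnK//.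
by rewrite posrE hist_Z_gt0.
Qed.

Lemma hist_Z_le (g f : R -> R) (c : R) (n : nat) : (0 < n)%N ->
  (forall x, x \in `[0, 1] -> g x <= f x + c) -> Z g n <= expR (n%:R * c) * Z f n.
Proof.
move=> n0 gf; rewrite /hist_Z -hist_meanZ; apply: (hist_mean_le a_gt0 sum_a A_lt1) => k kn.
by rewrite -expRD ler_expR -mulrDr ler_wpM2l// addrC gf// ratio_itv.
Qed.

Lemma free_energy_le (g f : R -> R) (c : R) (n : nat) : (0 < n)%N ->
  (forall x, x \in `[0, 1] -> g x <= f x + c) -> fe g n <= fe f n + c.
Proof.
move=> n0 /(hist_Z_le n0); rewrite !hist_ZE// -expRD ler_expR -mulrDr addrC.
by rewrite ler_pM2l ?ltr0n.
Qed.

Lemma free_energy_cst (c : R) (n : nat) : (0 < n)%N -> fe (cst c) n = c.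
Proof.
move=> n0; rewrite /free_energy /hist_Z /= hist_mean_cst expRK mulrA mulVf ?mul1r//.
by rewrite pnatr_eq0 -lt0n.
Qed.

(* The cone is concave, which makes the partition functions supermultiplicative. *)
Lemma free_energy_cone_cvg (b K y : R) : 0 <= K -> cvgn (fe (cone b K y)).
Proof.
move=> K0.
apply: (@almost_superadditive_cvg _ _ (S / (1 - A)) `|b|) => [n m n0 m0|n].
  have := @hist_mean_supermul _ _ _ _ a_gt0 sum_a A_lt1 sum_ia [::] n m
    (fun k => expR ((n + m)%:R * cone b K y (k%:R / (n + m)%:R)))
    (fun k => expR (n%:R * cone b K y (k%:R / n%:R)))
    (fun k => expR (m%:R * cone b K y (k%:R / m%:R))).
  rewrite -!/(hist_Z _ _ _) => h.
  rewrite -ler_expR expRD expRN !expRD !lnK ?posrE ?hist_Z_gt0// mulrC -expRN.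
  apply: h => [k|k|k l kn lm]; rewrite ?expR_ge0//.
  rewrite -expRD ler_expR.
  (* After this scaling, superadditivity is the triangle inequality for [|k - n y|]. *)
  have H (p j : nat) : (0 < p)%N ->
      p%:R * cone b K y (j%:R / p%:R) = p%:R * b - K * `|j%:R - p%:R * y|.
    move=> p0; rewrite /cone mulrBr mulrCA -{2}[p%:R]ger0_norm// -normrM.
    by rewrite mulrBr mulrCA mulfV ?mulr1// pnatr_eq0 -lt0n.
  rewrite !H ?addn_gt0 ?n0// natrD mulrDl addrACA lerD2l -opprD lerN2 -mulrDr.
  rewrite ler_wpM2l// natrD mulrDl opprD addrACA.
  exact: ler_normD.
case: n => [|n]; first by rewrite /hist_Z /= mul0r expR0 ln1 mulr0.
have := @free_energy_le (cone b K y) (cst `|b|) 0 n.+1 isT.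
rewrite free_energy_cst// addr0 /free_energy mulrC ler_pdivrMr ?ltr0n//.
apply=> x _; rewrite /cone lerBlDr (le_trans (ler_norm _))// lerDl mulr_ge0//.
Qed.

(** Each cone has its apex on the graph of [g] and is steep enough to fall below [g] before
    continuity at the apex loses control. Compactness leaves finitely many apexes. *)
Lemma cone_approx (g : R -> R) (e : R) : Cb01 g -> 0 < e ->
  exists (K : R -> R) (s : seq R),
  [/\ forall y, y \in s -> 0 <= K y,
      forall y x, y \in s -> x \in `[0, 1] -> cone (g y) (K y) y x <= g x + e &
      forall x, x \in `[0, 1] ->
        exists2 y, y \in s & g x <= cone (g y) (K y) y x + e].
Proof.
move=> Cg e0; have [_ [M0 hM0]] := Cg.
pose M := `|M0| + 1.
have hM x : x \in `[0, 1] -> `|g x| <= M.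
  move=> /hM0/le_trans; apply; rewrite (le_trans (ler_norm _))// lerDl//.
have M_gt0 : 0 < M by rewrite ltr_pwDr.
have e20 : 0 < e / 2 by rewrite divr_gt0.
have /choice[d hd] : forall y, exists d, y \in `[0, 1] -> 0 < d /\
    forall x, x \in `[0, 1] -> `|y - x| < d -> `|g y - g x| <= e / 2.
  move=> y; case: (boolP (y \in `[0, 1])) => y01; last by exists 0.
  by have [d d0 hd] := Cb01_near Cg y01 e20; exists d.
(* At distance [d y] the cone has dropped by [2 * M], from at most [M] to at most [- M], hence under
   [g]. *)
pose K y := 2 * M / d y.
have K0 y : y \in `[0, 1] -> 0 <= K y.
  by move=> /hd[d0 _]; rewrite divr_ge0 ?mulr_ge0// ltW.
(* Within [rho y] both [g] and the cone move by at most [e / 2]; the [+ 1] keeps the divisor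
   positive. *)
pose rho y := Num.min (d y) (e / 2 / (K y + 1)).
have [|y y01|s s01 cs] := @compact_ball_cover R `[0, 1]%classic rho.
- exact: segment_compact.
- have [d0 _] := hd y y01; rewrite /rho lt_min d0 divr_gt0//.
  by rewrite ltr_wpDl// K0.
exists K, s; split.
- by move=> y /s01/K0.
- move=> y x /s01 y01 x01; have [d0 hy] := hd y y01.
  rewrite /cone distrC; have [xy|xy] := ltP `|y - x| (d y).
    have := hy x x01 xy; rewrite ler_norml => /andP[_ h].
    have := mulr_ge0 (K0 y y01) (normr_ge0 (y - x)); lra.
  have : 2 * M <= K y * `|y - x| by rewrite /K mulrAC ler_pdivlMr// ler_pM2l// mulr_gt0.
  have := hM y y01; have := hM x x01; rewrite !ler_norml => /andP[? ?] /andP[? ?]; lra.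
- move=> x x01; have [y ys] := cs x x01; rewrite /rho lt_min => /andP[h1 h2].
  exists y => //; have y01 := s01 y ys; have [d0 hy] := hd y y01.
  have := hy x x01 h1; rewrite ler_norml => /andP[h3 _].
  move: h2; rewrite ltr_pdivlMr ?ltr_wpDl ?K0// => h2.
  rewrite /cone distrC.
  have := normr_ge0 (y - x) => h4.
  rewrite mulrC mulrDl mul1r in h2; lra.
Qed.

(** The exponential of a maximum is at most the sum of the exponentials. *)
Lemma hist_Z_le_sum (g : R -> R) (s : seq R) (c : R -> R -> R) (e : R) (n : nat) :
  (0 < n)%N ->
  (forall x, x \in `[0, 1] -> exists2 y, y \in s & g x <= c y x + e) ->
  Z g n <= expR (n%:R * e) * \sum_(y <- s) Z (c y) n.
Proof.
move=> n0 gc; rewrite /hist_Z -hist_mean_sum -hist_meanZ.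
apply: (hist_mean_le a_gt0 sum_a A_lt1) => k kn.
have [y ys hy] := gc _ (ratio_itv kn n0).
rewrite (big_rem y)//= mulrDr -expRD -[leLHS]addr0 lerD//.
  by rewrite ler_expR -mulrDr ler_wpM2l// addrC.
by rewrite mulr_ge0 ?expR_ge0// sumr_ge0// => z _; rewrite expR_ge0.
Qed.

(** For large [n] the free energy of [g] is close to the limit for the best cone. The cones depend
    on [e], so the Cauchy criterion is used in the form where the centre may depend on [e]. *)
Lemma free_energy_cvg (g : R -> R) : Cb01 g -> cvgn (fe g).
Proof.
move=> Cg; apply/cauchy_cvgP/cauchy_exP => e e0.
have e50 : 0 < e / 5 by rewrite divr_gt0.
have [K [s [K0 cg gc]]] := cone_approx Cg e50.
pose c y := cone (g y) (K y) y.
have cc y : y \in s -> cvgn (fe (c y)) by move=> /K0; exact: free_energy_cone_cvg.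
have s0 : s != [::].
  have : (0 : R) \in `[0, 1] by rewrite in_itv/= lexx ler01.
  by move=> /gc[y]; case: s {K0 cg gc cc}.
have [y0 y0s hy0] := seq_argmax (fun y => limn (fe (c y))) s0.
exists (limn (fe (c y0))).
have hn : \forall n \near \oo, forall y, y \in s -> `|limn (fe (c y)) - fe (c y) n| <= e / 5.
  by apply: near_infty_all => y ys; have /cvgrPdist_le := cc y ys; exact.
suff : \forall n \near \oo, ball (limn (fe (c y0))) e (fe g n) by [].
near=> n.
have n0 : (0 < n)%N by near: n; exact: nbhs_infty_gt.
have nR : 0 < n%:R :> R by rewrite ltr0n.
have hn' : forall y, y \in s -> `|limn (fe (c y)) - fe (c y) n| <= e / 5 by near: n.
have ls : ln (size s)%:R / (e / 5) <= n%:R by near: n; exact: nbhs_infty_ger.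
rewrite ler_pdivrMr// in ls.
have lo : fe (c y0) n <= fe g n + e / 5 by apply: free_energy_le => // x; exact: cg.
(* One share of [e / 5] each for the approximation by cones, the convergence of their energies, and
   the term [ln (size s) / n]. *)
have up : fe g n <= limn (fe (c y0)) + 3 * (e / 5).
  have : Z g n <= expR (n%:R * (limn (fe (c y0)) + 3 * (e / 5))).
    apply: le_trans (hist_Z_le_sum n0 gc) _.
    have : \sum_(y <- s) Z (c y) n <= \sum_(y <- s) expR (n%:R * (limn (fe (c y0)) + e / 5)).
      rewrite !big_seq; apply: ler_sum => y ys.
      rewrite hist_ZE// ler_expR ler_pM2l//.
      have := hn' y ys; have := hy0 y ys; rewrite ler_norml => ? /andP[? ?]; lra.
    rewrite big_const_seq count_predT iter_addr_0 => h.
    apply: le_trans (ler_wpM2l (expR_ge0 _) h) _.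
    rewrite -[_ *+ size s]mulr_natr -[(size s)%:R]lnK ?posrE ?ltr0n ?lt0n ?size_eq0//.
    by rewrite -!expRD ler_expR; lra.
  by rewrite hist_ZE// ler_expR ler_pM2l.
have := hn' y0 y0s; rewrite /ball/= ler_norml ltr_norml => /andP[? ?].
apply/andP; split; lra.
Unshelve. all: by end_near. Qed.

End FreeEnergy.

(** * Large deviation bounds for the history expectations *)

Section LargeDeviations.
Variables (R : realType) (a : nat -> R) (A S : R).
Hypothesis a_gt0 : forall i, 0 < a i.
Hypothesis sum_a : forall n, \sum_(0 <= i < n) a i <= A.
Hypothesis A_lt1 : A < 1.
Hypothesis sum_ia : forall n, \sum_(0 <= i < n) i%:R * a i <= S.

Local Notation Z := (hist_Z a).
Local Notation fe := (free_energy a).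
Local Notation prob := (hist_prob a).

(** A test function that beats [M] at a point still does so on a ball around it, where the
    exponential Chebyshev inequality applies; finitely many such balls cover [F]. *)
Lemma hist_prob_upper (F : set R) (M : R) :
  compact F -> F `<=` `[0, 1] ->
  (forall x, F x -> exists2 g, Cb01 g & M < g x - limn (fe g)) ->
  exists N : nat, \forall n \near \oo, prob n F <= N%:R * expR (- (n%:R * M)).
Proof.
move=> cF F01 hF.
have /choice[g hg] : forall x, exists g, F x -> Cb01 g /\ M < g x - limn (fe g).
  move=> x; have [/hF[g Cg hg]|nF] := pselect (F x); first by exists g.
  by exists (cst 0).
pose l x := limn (fe (g x)).
(* Half of the gap is spent on the oscillation of [g x] over a ball, the other half on the
   convergence of its free energy. *)
pose eta x := (g x x - l x - M) / 2.
have eta0 x : F x -> 0 < eta x.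
  by move=> /hg[_ h]; rewrite divr_gt0// subr_gt0.
have /choice[d hd] : forall x, exists d, F x -> 0 < d /\ forall y, y \in `[0, 1] ->
    `|x - y| < d -> `|g x x - g x y| <= eta x.
  move=> x; have [Fx|nF] := pselect (F x); last by exists 0.
  have [Cg _] := hg x Fx.
  have [d d0 hd] := Cb01_near Cg (F01 _ Fx) (eta0 x Fx).
  by exists d.
have [s sF cs] := compact_ball_cover cF (fun x Fx => proj1 (hd x Fx)).
exists (size s).
have hn : \forall n \near \oo, forall x, x \in s -> `|l x - fe (g x) n| <= eta x.
  apply: near_infty_all => x xs; have Fx := sF x xs.
  have /cvgrPdist_le := free_energy_cvg a_gt0 sum_a A_lt1 sum_ia (proj1 (hg x Fx)).
  by apply; exact: eta0.
near=> n.
have n0 : (0 < n)%N by near: n; exact: nbhs_infty_gt.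
have hn' : forall x, x \in s -> `|l x - fe (g x) n| <= eta x by near: n.
(* On the ball around [x], [g x] is at least [M + l x + eta x], so the summand of [x] dominates the
   indicator there. *)
have : prob n F <= \sum_(x <- s) expR (- (n%:R * (M + l x + eta x))) * Z (g x) n.
  under eq_bigr do rewrite /hist_Z -hist_meanZ.
  rewrite -hist_mean_sum; apply: (hist_mean_le a_gt0 sum_a A_lt1) => k kn.
  case: asboolP => [Fk|_]; last first.
    by apply: sumr_ge0 => x _; rewrite mulr_ge0 ?expR_ge0.
  have [x xs xk] := cs _ Fk.
  rewrite (big_rem x)//= -[leLHS]addr0 lerD//; last first.
    by apply: sumr_ge0 => z _; rewrite mulr_ge0 ?expR_ge0.
  rewrite -expRD -[leLHS]expR0 ler_expR addrC subr_ge0 ler_wpM2l//.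
  have [_ hx] := hd x (sF x xs).
  have := hx _ (ratio_itv kn n0) xk.
  rewrite ler_norml => /andP[_ h].
  have : eta x * 2 = g x x - l x - M by rewrite /eta mulfVK.
  lra.
move=> /le_trans; apply.
have -> : (size s)%:R * expR (- (n%:R * M)) = \sum_(x <- s) expR (- (n%:R * M)).
  by rewrite big_const_seq count_predT iter_addr_0 mulr_natl.
rewrite !big_seq; apply: ler_sum => x xs.
rewrite (hist_ZE a_gt0 sum_a A_lt1)// -expRD ler_expR -!mulrN -mulrDr ler_wpM2l//.
have := hn' x xs; rewrite ler_norml => /andP[h _]; lra.
Unshelve. all: by end_near. Qed.

(* A steep cone at [x] sees only the neighbourhood [U] of [x], up to an
   exponentially negligible error. *)
Lemma hist_prob_lower (U : set R) (x L : R) :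
  open U -> U x -> x \in `[0, 1] ->
  (forall K, 0 <= K -> L < limn (fe (cone 0 K x))) ->
  \forall n \near \oo, expR (n%:R * L) <= prob n (U `&` `[0, 1]).
Proof.
move=> oU Ux x01 hL.
have /nbhs_ballP[d /= d0 hd] : nbhs x U by exact: open_nbhs_nbhs.
(* With this slope the cone is at most [- |L|], hence at most [L], at distance [d] or more from
   [x]. *)
pose K := `|L| / d.
have K0 : 0 <= K by rewrite divr_ge0// ltW.
set l := limn (fe (cone 0 K x)).
have Ll : L < l := hL K K0.
pose eta := (l - L) / 2.
have eta0 : 0 < eta by rewrite divr_gt0// subr_gt0.
have /cvgrPdist_le/(_ _ eta0) hn := free_energy_cone_cvg a_gt0 sum_a A_lt1 sum_ia (b := 0) (y := x) K0.
near=> n.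
have n0 : (0 < n)%N by near: n; exact: nbhs_infty_gt.
(* Makes [expR (n * eta)] at least [2]: the partition function is then at least twice
   [expR (n * L)], and only one copy is lost outside [U]. *)
have n1 : ln 2 / eta <= n%:R by near: n; exact: nbhs_infty_ger.
rewrite ler_pdivrMr// in n1.
have hn' : `|l - fe (cone 0 K x) n| <= eta by near: n.
have up : Z (cone 0 K x) n <= prob n (U `&` `[0, 1]) + expR (n%:R * L).
  rewrite -[X in _ + X](hist_mean_cst a [::] n) -[prob _ _]mul1r -hist_mean_lin.
  apply: (hist_mean_le a_gt0 sum_a A_lt1) => k kn.
  have k01 := ratio_itv (R := R) kn n0.
  rewrite mul1r; case: asboolP => [_|nUk].
    rewrite -[leLHS]addr0 lerD ?expR_ge0// expR_le1 mulr_ge0_le0//.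
    by rewrite /cone sub0r oppr_le0 mulr_ge0.
  rewrite add0r ler_expR ler_wpM2l// /cone sub0r.
  have : d <= `|k%:R / n%:R - x|.
    rewrite leNgt; apply/negP => h; apply: nUk; split => //.
    by apply: hd; rewrite /ball/= distrC.
  move=> /(ler_wpM2l K0); rewrite {1}/K mulfVK ?gt_eqF//.
  have := lerNnormlW (lexx `|L|); lra.
have lo : 2 * expR (n%:R * L) <= Z (cone 0 K x) n.
  rewrite (hist_ZE a_gt0 sum_a A_lt1)// -{1}[2]lnK ?posrE// -expRD ler_expR.
  have h : L + eta <= fe (cone 0 K x) n.
    have : eta * 2 = l - L by rewrite /eta mulfVK.
    move: hn'; rewrite ler_norml => /andP[_ ?]; lra.
  have := ler_wpM2l (ler0n R n) h; rewrite mulrDr; lra.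
lra.
Unshelve. all: by end_near. Qed.

End LargeDeviations.

(** * The law of the process *)

Definition DTHP_count {T : Type} (xi : nat -> T -> bool) (n : nat) (w : T) : nat :=
  \sum_(1 <= i < n.+1) xi i w.

(** Times count from [1]: the list runs through the times [n] down to [1], and [s 0] is never
    read. *)
Definition history (s : nat -> bool) (n : nat) : seq bool := mkseq (fun i => s (n - i)%N) n.

Lemma DTHP_HE {R : realType} {T : Type} (xi : nat -> T -> bool) (n : nat) (w : T) :
  DTHP_H xi n w = (DTHP_count xi n w)%:R :> R.
Proof. by rewrite /DTHP_count natr_sum. Qed.

Lemma DTHP_countS {T : Type} (xi : nat -> T -> bool) (n : nat) (w : T) :
  DTHP_count xi n.+1 w = (DTHP_count xi n w + xi n.+1 w)%N.
Proof. by rewrite /DTHP_count big_nat_recr. Qed.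

(** The convolution of [is_DTHP], summed by lag instead of by time. *)
Lemma history_rate {R : realType} (a : nat -> R) (s : nat -> bool) (n : nat) :
  a 0%N + \sum_(1 <= i < n.+1) a (n.+1 - i)%N * (s i : nat)%:R
    = hist_rate a (history s n).
Proof.
rewrite /hist_rate size_mkseq big_add1 big_nat_rev /= add0n; congr (_ + _).
rewrite !big_nat; apply: eq_bigr => i /andP[_ lin].
by rewrite nth_mkseq// subSS subKn// subnSK.
Qed.

Definition extend_path (s : nat -> bool) (n : nat) (b : bool) (i : nat) : bool :=
  if i == n.+1 then b else s i.

Lemma history_extend (s : nat -> bool) (n : nat) (b : bool) :
  history (extend_path s n b) n.+1 = b :: history s n.
Proof.
apply: (@eq_from_nth _ false); first by rewrite [RHS]/size -/size !size_mkseq.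
move=> i; rewrite size_mkseq => hi; rewrite nth_mkseq// /extend_path.
case: i hi => [|i] hi; first by rewrite subn0 eqxx.
rewrite (_ : nth _ (b :: _) _ = nth false (history s n) i)// nth_mkseq// subSS.
rewrite ifN//; lia.
Qed.

(** Note the shift: [prefix_event xi n.+1] fixes the times [1] to [n]. *)
Lemma prefix_event_extend {T : Type} (xi : nat -> T -> bool) (n : nat)
    (s : nat -> bool) (b : bool) :
  prefix_event xi n.+2 (extend_path s n b)
    = prefix_event xi n.+1 s `&` [set w | xi n.+1 w = b].
Proof.
apply/seteqP; split=> [w h|w [h1 h2] i /andP[i1 i2]].
  split=> [i /andP[i1 i2]|] /=.
    rewrite h; last lia.
    rewrite /extend_path ifN//; lia.
  by rewrite h ?ltnSn// /extend_path eqxx.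
rewrite /extend_path; case: eqP => [->//|/eqP ni]; apply: h1; lia.
Qed.

Section ProbabilityOfPaths.
Variables (R : realType) (d : measure_display) (T : measurableType d).
Variables (P : probability T R) (a : nat -> R) (xi : nat -> T -> bool).
Hypothesis xiP : is_DTHP P a xi.

Local Notation count := (DTHP_count xi).

Lemma measurable_prefix_event (n : nat) (s : nat -> bool) :
  measurable (prefix_event xi n.+1 s).
Proof.
elim: n s => [|n IH] s.
  have -> : prefix_event xi 1 s = setT.
    by apply/seteqP; split=> // w _ i; lia.
  exact: measurableT.
(* Every path extends itself by its own bit at time [n.+1]. *)
have -> : prefix_event xi n.+2 s = prefix_event xi n.+2 (extend_path s n (s n.+1)).
  congr prefix_event; apply/funext => i; rewrite /extend_path.
  by case: eqP => [->|].
rewrite prefix_event_extend; apply: measurableI => //.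
have m1 := proj1 xiP n.+1.
case: (s n.+1) => //.
have -> : [set w | xi n.+1 w = false] = ~` [set w | xi n.+1 w].
  by apply/seteqP; split=> w /=; case: (xi n.+1 w).
exact: measurableC.
Qed.

Lemma measurable_count_preimage (n : nat) (B : set nat) : measurable (count n @^-1` B).
Proof.
elim: n B => [|n IH] B.
  have [B0|B0] := pselect (B 0%N).
    have -> : count 0 @^-1` B = setT.
      by apply/seteqP; split=> // w _ /=; rewrite /DTHP_count big_geq.
    exact: measurableT.
  have -> : count 0 @^-1` B = set0.
    by apply/seteqP; split=> // w /=; rewrite /DTHP_count big_geq.
  exact: measurable0.
have m1 := proj1 xiP n.+1.
have -> : count n.+1 @^-1` B =
    (count n @^-1` (succn @^-1` B) `&` [set w | xi n.+1 w])
    `|` (count n @^-1` B `&` ~` [set w | xi n.+1 w]).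
  apply/seteqP; split=> w /=; rewrite DTHP_countS.
    by case: (xi n.+1 w); rewrite ?addn1 ?addn0; [left|right].
  by move=> [[]|[]]; case: (xi n.+1 w) => //; rewrite ?addn1 ?addn0.
by apply: measurableU; apply: measurableI => //; exact: measurableC.
Qed.

Lemma measurable_count_comp (n : nat) (phi : nat -> R) (D : set T) :
  measurable_fun D (fun w => (phi (count n w))%:E).
Proof.
move=> mD Y _; apply: measurableI => //.
exact: (measurable_count_preimage n [set k | Y (phi k)%:E]).
Qed.

(** [is_DTHP] gives the case of an arrival; the other one follows by taking the complement within
    the past event. *)
Lemma prefix_prob_extend (n : nat) (s : nat -> bool) (b : bool) :
  P (prefix_event xi n.+2 (extend_path s n b)) =
  ((if b then hist_rate a (history s n) else 1 - hist_rate a (history s n))%:E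
     * P (prefix_event xi n.+1 s))%E.
Proof.
have m1 := proj1 xiP n.+1.
have mE := measurable_prefix_event n s.
have Pt : P (prefix_event xi n.+1 s `&` [set w | xi n.+1 w]) =
    ((hist_rate a (history s n))%:E * P (prefix_event xi n.+1 s))%E.
  by rewrite (proj2 xiP)// history_rate.
rewrite prefix_event_extend; case: b => //.
have -> : prefix_event xi n.+1 s `&` [set w | xi n.+1 w = false]
    = prefix_event xi n.+1 s `\` [set w | xi n.+1 w].
  by apply/seteqP; split=> w [h1 h2]; split=> //; move: h2 => /=; case: (xi n.+1 w).
have fE := fin_num_measure P _ mE.
rewrite measureD//; last by rewrite ltey_eq fE.
by rewrite EFinB muleBl// mul1e; congr (_ - _)%E; exact: Pt.
Qed.

(** Splitting the past event on the next bit mirrors the recursion of [hist_mean]. Multiplying by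
    the probability of the past, rather than conditioning on it, avoids a division. *)
Lemma prefix_expectation (m n : nat) (s : nat -> bool) (phi : nat -> R) :
  (\int[P]_(w in prefix_event xi n.+1 s) (phi (count (n + m)%N w))%:E =
   (hist_mean a (history s n) m (fun k => phi (\sum_(1 <= i < n.+1) s i + k)%N))%:E
     * P (prefix_event xi n.+1 s))%E.
Proof.
elim: m n s => [|m IH] n s.
  rewrite /= !addn0 -integral_cst; last exact: measurable_prefix_event.
  apply: eq_integral => w; rewrite inE => hw; congr (phi _)%:E.
  by rewrite /DTHP_count !big_nat; apply: eq_bigr => i hi; rewrite hw.
have E : prefix_event xi n.+1 s =
    prefix_event xi n.+2 (extend_path s n true)
    `|` prefix_event xi n.+2 (extend_path s n false).
  rewrite !prefix_event_extend -setIUr; apply/seteqP; split=> [w hw|w []//].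
  by split=> //=; case: (xi n.+1 w); [left|right].
rewrite [in LHS]E integral_setU; first last.
- rewrite !prefix_event_extend; apply/disj_setPS => w [[_ /= h1] [_ /= h2]].
  by rewrite h1 in h2.
- exact: measurable_count_comp.
- exact: measurable_prefix_event.
- exact: measurable_prefix_event.
have sumE b : (\sum_(1 <= i < n.+2) extend_path s n b i)%N
    = (\sum_(1 <= i < n.+1) s i + b)%N.
  rewrite big_nat_recr//= {2}/extend_path eqxx; congr (_ + _)%N.
  rewrite !big_nat; apply: eq_bigr => i /andP[_ hi].
  by rewrite /extend_path ifN// neq_ltn hi.
rewrite -addSnnS !IH !history_extend !prefix_prob_extend !sumE.
have fE := fin_num_measure P _ (measurable_prefix_event n s).
rewrite -(fineK fE) -!EFinM -EFinD; congr _%:E => /=.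
have -> : (fun k => phi (\sum_(1 <= i < n.+1) s i + true + k)%N)
    = (fun k => phi (\sum_(1 <= i < n.+1) s i + k.+1)%N).
  by apply/funext => k; rewrite addn1 addSnnS.
have -> : (fun k => phi (\sum_(1 <= i < n.+1) s i + false + k)%N)
    = (fun k => phi (\sum_(1 <= i < n.+1) s i + k)%N).
  by apply/funext => k; rewrite addn0.
ring.
Qed.

Lemma count_expectation (n : nat) (phi : nat -> R) :
  (\int[P]_w (phi (count n w))%:E = (hist_mean a [::] n phi)%:E)%E.
Proof.
have E : prefix_event xi 1 (fun=> false) = setT.
  by apply/seteqP; split=> // w _ i; lia.
have := prefix_expectation n 0 (fun=> false) phi.
by rewrite E probability_setT mule1 add0n big_geq.
Qed.

Lemma Gamma_seqE (g : R -> R) : Gamma_seq P xi g = free_energy a g.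
Proof.
apply/funext => n; rewrite /Gamma_seq /free_energy /hist_Z.
have := count_expectation n (fun k => expR (n%:R * g (k%:R / n%:R))).
by under eq_integral do rewrite -DTHP_HE; move=> ->.
Qed.

Lemma DTHP_prob (n : nat) (B : set R) :
  P [set w | B (DTHP_H xi n w / n%:R)] = (hist_prob a n B)%:E.
Proof.
rewrite /hist_prob -count_expectation.
set C := [set w | _].
have mC : measurable C.
  have -> : C = count n @^-1` [set k | B (k%:R / n%:R)].
    by apply/seteqP; split=> w; rewrite /C/= DTHP_HE.
  exact: measurable_count_preimage.
rewrite -[C]setIT -integral_indic//; apply: eq_integral => w _; congr _%:E.
by rewrite indicE -DTHP_HE.
Qed.

End ProbabilityOfPaths.

(** * The rate function *)

Lemma series_le_lim {R : realType} (u : nat -> R) :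
  (forall i, 0 <= u i) -> cvgn (series u) ->
  forall n, \sum_(0 <= i < n) u i <= limn (series u).
Proof.
move=> u0 cu n; apply: (nondecreasing_cvgn_le _ cu n).
by apply/nondecreasing_series => i _ _; exact: u0.
Qed.

Lemma limn_esup_le_near {R : realType} (u : nat -> \bar R) (b : \bar R) :
  (\forall n \near \oo, (u n <= b)%E) -> (limn_esup u <= b)%E.
Proof.
move=> h; apply: ereal_inf_le; exists (ereal_sup (u @` [set n | (u n <= b)%E])).
  by exists [set n | (u n <= b)%E].
by apply: ge_ereal_sup => _ [n /= hn <-].
Qed.

Lemma limn_einf_ge_near {R : realType} (u : nat -> \bar R) (b : \bar R) :
  (\forall n \near \oo, (b <= u n)%E) -> (b <= limn_einf u)%E.
Proof.
move=> h; rewrite /limn_einf leeNr; apply: limn_esup_le_near.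
by apply: filterS h => n; rewrite leeN2.
Qed.

Lemma closed_Cb01_le {R : realType} (g : R -> R) (b : R) :
  Cb01 g -> closed [set x | x \in `[0, 1] /\ g x <= b].
Proof.
move=> Cg x cx.
have x01 : x \in `[0, 1].
  have : closed (`[0, 1]%classic : set R) by exact: itv_closed.
  by apply=> B /cx[y [[y01 _] By]]; exists y.
split=> //; apply/ler_addgt0Pr => e e0.
have [d d0 hd] := Cb01_near Cg x01 e0.
have [y [[y01 gy] xy]] := cx _ (nbhsx_ballx x d d0).
have := hd y y01 xy; rewrite ler_norml => /andP[_ h]; lra.
Qed.

(** Lets a large deviation bound be proved at real levels even where the rate is infinite. *)
Lemma lee_of_real_upper {R : realType} (x y : \bar R) :
  (forall r : R, (x < r%:E)%E -> (y <= r%:E)%E) -> (y <= x)%E.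
Proof.
case: x => [x||] h; last by rewrite (eq_ninfty (fun r => h r (ltNyr r))).
  by apply/lee_addgt0Pr => e e0; rewrite -EFinD; apply: h; rewrite lte_fin ltrDl.
exact: leey.
Qed.

Lemma lee_of_real_lower {R : realType} (x y : \bar R) :
  (forall r : R, (r%:E < y)%E -> (r%:E <= x)%E) -> (y <= x)%E.
Proof.
move=> h; rewrite -leeN2; apply: lee_of_real_upper => r.
by rewrite lteNl leeNl -EFinN => /h.
Qed.

Lemma scaled_lne_le {R : realType} (n : nat) (p c : R) : (0 < n)%N ->
  p <= expR (n%:R * c) -> ((n%:R^-1)%:E * lne p%:E <= c%:E)%E.
Proof.
move=> n0 hp; have nR : 0 < n%:R :> R by rewrite ltr0n.
(* For [p <= 0] the value of [lne] is [-oo], and the positive factor keeps it there. *)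
have [p0|p0] := leP p 0.
  by rewrite le0_lneNy ?lee_fin// gt0_muleNy ?leNye// lte_fin invr_gt0.
rewrite lne_EFin// -EFinM lee_fin ler_pdivrMl//.
by rewrite -ler_expR lnK.
Qed.

Lemma scaled_lne_ge {R : realType} (n : nat) (p c : R) : (0 < n)%N ->
  expR (n%:R * c) <= p -> (c%:E <= (n%:R^-1)%:E * lne p%:E)%E.
Proof.
move=> n0 hp; have nR : 0 < n%:R :> R by rewrite ltr0n.
have p0 : 0 < p := lt_le_trans (expR_gt0 _) hp.
rewrite lne_EFin// -EFinM lee_fin ler_pdivlMl//.
by rewrite -ler_expR lnK.
Qed.

Section Rate.
Variables (R : realType) (d : measure_display) (T : measurableType d).
Variables (P : probability T R) (a : nat -> R) (xi : nat -> T -> bool).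
Variables (A S : R).
Hypothesis a_gt0 : forall i, 0 < a i.
Hypothesis sum_a : forall n, \sum_(0 <= i < n) a i <= A.
Hypothesis A_lt1 : A < 1.
Hypothesis sum_ia : forall n, \sum_(0 <= i < n) i%:R * a i <= S.
Hypothesis xiP : is_DTHP P a xi.

Local Notation rate := (rateR P xi).

Lemma GammaE (g : R -> R) : Gamma P xi g = limn (free_energy a g).
Proof. by rewrite /Gamma (Gamma_seqE xiP). Qed.

Lemma rateR_ge (g : R -> R) (x : R) : Cb01 g ->
  ((g x - Gamma P xi g)%:E <= rate x)%E.
Proof. by move=> Cg; apply: ereal_sup_ubound; exists g. Qed.

(** A sublevel set of a supremum is the intersection of the sublevel sets of the test functions,
    each closed in the compact [[0, 1]]. The zero function, with [Gamma] equal to [0], gives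
    nonnegativity. *)
Lemma rateR_good : good_rate_function01 rate.
Proof.
have cl alpha : closed [set x | x \in `[0, 1] /\ (rate x <= alpha%:E)%E].
  have -> : [set x | x \in `[0, 1] /\ (rate x <= alpha%:E)%E] =
      \bigcap_(g in @Cb01 R) [set x | x \in `[0, 1] /\ g x <= alpha + Gamma P xi g].
    apply/seteqP; split=> [x [x01 hx] g Cg|x hx].
      split=> //; have := le_trans (rateR_ge x Cg) hx.
      by rewrite lee_fin lerBlDr.
    (* Membership in [[0, 1]] is read off from one member of the family. *)
    split; first by have [] := hx _ (Cb01_cone 0 0 0).
    apply: ge_ereal_sup => _ [g Cg <-]; have [_] := hx g Cg.
    by rewrite lee_fin lerBlDr.
  by apply: closed_bigI => g Cg; exact: closed_Cb01_le.
split=> [x _|].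
  apply: le_trans (rateR_ge x (Cb01_cone 0 0 0)).
  rewrite lee_fin GammaE.
  have -> : limn (free_energy a (cone 0 0 0)) = 0.
    apply/cvg_lim => //; apply: cvg_near_cst; near=> n.
    have -> : cone 0 0 0 = cst (0 : R) by apply/funext => y; rewrite /cone mul0r subr0.
    by apply: free_energy_cst; near: n; exact: nbhs_infty_gt.
  by rewrite /cone mul0r !subr0.
split=> // alpha; apply: (subclosed_compact (cl alpha) (@segment_compact R 0 1)).
by move=> x [].
Unshelve. all: by end_near. Qed.

(** A level [- r] below the infimum of the rate is beaten at each point of [F] by some test
    function, as [hist_prob_upper] requires; the slack [e] absorbs its factor [N]. *)
Lemma rateR_upper (F : set R) : closed F -> F `<=` `[0, 1] ->
  (limn_esup (ldp_seq P xi F) <= - ereal_inf (rate @` F))%E.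
Proof.
move=> clF F01; apply: lee_of_real_upper => r; rewrite lteNl -EFinN => hr.
have cF : compact F by exact: subclosed_compact clF (@segment_compact R 0 1) F01.
have [N hN] : exists N : nat, \forall n \near \oo,
    hist_prob a n F <= N%:R * expR (- (n%:R * - r)).
  apply: (hist_prob_upper a_gt0 sum_a A_lt1 sum_ia) => // x Fx.
  have : ((- r)%:E < rate x)%E.
    by apply: lt_le_trans hr _; apply: ereal_inf_lbound; exists x.
  move=> /ereal_sup_gt[_ [g Cg <-]]; rewrite lte_fin GammaE => hg.
  by exists g.
apply/lee_addgt0Pr => e e0; apply: limn_esup_le_near; near=> n.
have n0 : (0 < n)%N by near: n; exact: nbhs_infty_gt.
have hn : ln N.+1%:R / e <= n%:R by near: n; exact: nbhs_infty_ger.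
rewrite ler_pdivrMr// in hn.
rewrite /ldp_seq (DTHP_prob xiP) -EFinD; apply: scaled_lne_le => //.
have hp : hist_prob a n F <= N%:R * expR (- (n%:R * - r)) by near: n.
(* [N] may be [0], so [N.+1] is used where a logarithm is needed. *)
apply: (le_trans hp); apply: (@le_trans _ _ (N.+1%:R * expR (- (n%:R * - r)))).
  by rewrite ler_wpM2r ?expR_ge0// ler_nat.
rewrite -[N.+1%:R]lnK ?posrE// -expRD ler_expR mulrN opprK mulrDr; lra.
Unshelve. all: by end_near. Qed.

(** The cone [cone 0 K x] vanishes at [x], so testing the rate with it gives
    [- Gamma <= rate x < - r] for every slope, as [hist_prob_lower] requires. *)
Lemma rateR_lower (U : set R) : open U ->
  let G := U `&` `[0, 1] in
  (- ereal_inf (rate @` G) <= limn_einf (ldp_seq P xi G))%E.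
Proof.
move=> oU; cbv zeta; set G := U `&` _.
rewrite leeNl; apply: le_ereal_inf_tmp => _ [x [Ux x01] <-].
rewrite leeNl; apply: lee_of_real_lower => r; rewrite lteNr -EFinN => hr.
apply: limn_einf_ge_near.
have hG : \forall n \near \oo, expR (n%:R * r) <= hist_prob a n G.
  apply: (hist_prob_lower a_gt0 sum_a A_lt1 sum_ia) Ux x01 _ => // K K0.
  have := le_lt_trans (rateR_ge x (Cb01_cone 0 K x)) hr.
  have -> : cone 0 K x x = 0 by rewrite /cone subrr normr0 mulr0 subr0.
  by rewrite sub0r lte_fin ltrN2 GammaE.
near=> n; rewrite /ldp_seq (DTHP_prob xiP); apply: scaled_lne_ge.
  by near: n; exact: nbhs_infty_gt.
by near: n.
Unshelve. all: by end_near. Qed.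

End Rate.

Theorem theorem4p1 (R : realType) (d : measure_display) (T : measurableType d)
    (P : probability T R) (a : nat -> R) (xi : nat -> T -> bool) :
  hawkes_coeffs a -> is_DTHP P a xi ->
  (forall g : R -> R, Cb01 g -> cvgn (Gamma_seq P xi g)) /\
  good_rate_function01 (rateR P xi) /\
  (forall F : set R, closed F -> F `<=` `[0, 1] ->
     (limn_esup (ldp_seq P xi F) <= - ereal_inf (rateR P xi @` F))%E) /\
  (forall U : set R, open U ->
     let G := U `&` `[0, 1] in
     (- ereal_inf (rateR P xi @` G) <= limn_einf (ldp_seq P xi G))%E).
Proof.
move=> [a_gt0 [cva [A_lt1 cvia]]] xiP.
(* The limits of the two series serve as [A] and [S]. *)
have sum_a := series_le_lim (fun i => ltW (a_gt0 i)) cva.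
have sum_ia := series_le_lim (fun i => mulr_ge0 (ler0n R i) (ltW (a_gt0 i))) cvia.
split; first by move=> g Cg; rewrite (Gamma_seqE xiP); exact: free_energy_cvg Cg.
split; first exact: rateR_good xiP.
split; first by move=> F; exact: rateR_upper xiP _.
by move=> U; exact: rateR_lower xiP _.
Qed.
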